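(* Let $\omega:\mathbb{N}_0\times\mathbb{N}_0\to\{-1,1\}$ be the twist function of any one of the eight Cayley-Dickson doubling products $P_0,P_1,P_2,P_3,P_0^\top,P_1^\top,P_2^\top,P_3^\top$. Let $p,q,k\in\mathbb{N}_0$ and let $N$ be a positive integer. If $2^{N-1}\le p<2^N$, $2^{N-1}\le q<2^N$ and $k\ge0$, then $$\omega(p,q)=\omega(p+k2^N,\,q+k2^N).$$
   Context: $\mathbb{N}_0$ is the set of non-negative integers. For $p,q\in\mathbb{N}_0$, $p\oplus q$ is the bitwise exclusive-or of their binary representations. Cayley-Dickson algebras. For $n\ge 0$, let $\mathbb{A}_n$ be the real vector space of real sequences $x=x_0,x_1,x_2,\dots$ with $x_i=0$ for all $i\ge 2^n$; thus $\mathbb{A}_n\subset\mathbb{A}_{n+1}$, and $\mathbb{A}_0=\mathbb{R}$ (a real number $x$ is identified with $x,0,0,\dots$). Put $\mathbb{A}=\bigcup_n\mathbb{A}_n$. An ordered pair $(a,b)$ of sequences is identified with the shuffled sequence $a_0,b_0,a_1,b_1,a_2,b_2,\dots$, so that $\mathbb{A}_{n+1}=\{(a,b): a,b\in\mathbb{A}_n\}$. The conjugate of $x$ is $x^*=x_0,-x_1,-x_2,\dots$; equivalently $(a,b)^*=(a^*,-b)$. Let $e_k$ ($k\ge0$) be the standard unit basis sequences ($1$ in position $k$, $0$ elsewhere); equivalently $e_0=1$, $e_{2k}=(e_k,0)$, $e_{2k+1}=(0,e_k)$ for $k\ge 0$. Doubling products. Each of the following eight formulas defines recursively a bilinear product on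 $\mathbb{A}$: on $\mathbb{A}_0=\mathbb{R}$ it is ordinary multiplication, and the product of two elements of $\mathbb{A}_{n+1}$ is given in terms of the product on $\mathbb{A}_n$ by $P_0$: $(a,b)(c,d)=(ca-b^*d,\ da^*+bc)$; $P_1$: $(a,b)(c,d)=(ca-db^*,\ a^*d+cb)$; $P_2$: $(a,b)(c,d)=(ac-b^*d,\ da^*+bc)$; $P_3$: $(a,b)(c,d)=(ac-db^*,\ a^*d+cb)$; $P_0^\top$: $(a,b)(c,d)=(ca-bd^*,\ ad+c^*b)$; $P_1^\top$: $(a,b)(c,d)=(ca-d^*b,\ da+bc^* )$; $P_2^\top$: $(a,b)(c,d)=(ac-bd^*,\ ad+c^*b)$; $P_3^\top$: $(a,b)(c,d)=(ac-d^*b,\ da+bc^* )$. Twist. For each of the eight products there is a unique function $\omega:\mathbb{N}_0\times\mathbb{N}_0\to\{-1,1\}$, called the twist of that product, such that $e_pe_q=\omega(p,q)\,e_{p\oplus q}$ for all $p,q\in\mathbb{N}_0$. *)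

(* Defs.v *)
From HB Require Import structures.
From Stdlib Require PeanoNat.
From mathcomp Require Import all_boot all_order all_algebra.
From mathcomp Require Import reals zify.

Set Implicit Arguments.
Unset Strict Implicit.
Unset Printing Implicit Defensive.

Import Order.TTheory GRing.Theory Num.Theory.
Local Open Scope ring_scope.

(* The space A of finitely supported real sequences is {poly R}, used only as
   an R-module of sequences: x`_i is the i-th term, A_n is {x | size x <= 2^n},
   a real number r is r%:P, and e_k is 'X^k. The polynomial product plays no
   role. *)

Inductive doubling_product : Type :=
  | P0 | P1 | P2 | P3 | P0T | P1T | P2T | P3T.

Definition cdconj (R : realType) (x : {poly R}) : {poly R} :=
  \poly_(i < size x) (if i == 0%N then x`_i else - x`_i).

(* The shuffled sequence a_0, b_0, a_1, b_1, ...; its inverse is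
   x |-> (even_poly x, odd_poly x), see shuffleK below. *)
Definition shuffle (R : realType) (a b : {poly R}) : {poly R} :=
  \poly_(i < (maxn (size a) (size b)).*2)
    (if odd i then b`_(i./2) else a`_(i./2)).

Definition cddouble (R : realType) (P : doubling_product)
    (mul : {poly R} -> {poly R} -> {poly R}) (a b c d : {poly R}) :
    {poly R} * {poly R} :=
  let: J := @cdconj R in
  match P with
  | P0  => (mul c a - mul (J b) d, mul d (J a) + mul b c)
  | P1  => (mul c a - mul d (J b), mul (J a) d + mul c b)
  | P2  => (mul a c - mul (J b) d, mul d (J a) + mul b c)
  | P3  => (mul a c - mul d (J b), mul (J a) d + mul c b)
  | P0T => (mul c a - mul b (J d), mul a d + mul (J c) b)
  | P1T => (mul c a - mul (J d) b, mul d a + mul b (J c))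
  | P2T => (mul a c - mul b (J d), mul a d + mul (J c) b)
  | P3T => (mul a c - mul (J d) b, mul d a + mul b (J c))
  end.

(* The product on A_n; meaningful when size x, size y <= 2 ^ n. *)
Fixpoint cdmul_rec (R : realType) (P : doubling_product) (n : nat)
    (x y : {poly R}) : {poly R} :=
  if n is m.+1 then
    let: (u, v) := cddouble P (cdmul_rec P m)
                     (even_poly x) (odd_poly x) (even_poly y) (odd_poly y) in
    shuffle u v
  else (x`_0 * y`_0)%:P.

(* The product on A, computed in the smallest A_n that contains both factors;
   by cdmul_level any larger n gives the same result. *)
Definition cdmul (R : realType) (P : doubling_product) (x y : {poly R}) :
    {poly R} :=
  cdmul_rec P (up_log 2 (maxn (size x) (size y))) x y.

Definition is_twist (R : realType) (P : doubling_product)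
    (w : nat -> nat -> int) : Prop :=
  (forall p q, w p q = 1 \/ w p q = -1) /\
  (forall p q, cdmul P ('X^p : {poly R}) 'X^q
               = (w p q)%:~R *: 'X^(Nat.lxor p q)).

Lemma coef_cdconj (R : realType) (x : {poly R}) i :
  (cdconj x)`_i = if i == 0%N then x`_i else - x`_i.
Proof.
rewrite coef_poly; case: ltnP => // le_x_i.
by rewrite nth_default // oppr0 if_same.
Qed.

Lemma coef_shuffle (R : realType) (a b : {poly R}) i :
  (shuffle a b)`_i = if odd i then b`_(i./2) else a`_(i./2).
Proof.
rewrite coef_poly; case: ltnP => // le_i.
have : (maxn (size a) (size b) <= i./2)%N.
  by rewrite -[X in (X <= _)%N]doubleK half_leq.
by rewrite geq_max => /andP[? ?]; rewrite !nth_default // if_same.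
Qed.

Lemma even_shuffle (R : realType) (a b : {poly R}) : even_poly (shuffle a b) = a.
Proof.
by apply/polyP => i; rewrite coef_even_poly coef_shuffle odd_double doubleK.
Qed.

Lemma odd_shuffle (R : realType) (a b : {poly R}) : odd_poly (shuffle a b) = b.
Proof.
apply/polyP => i; rewrite coef_odd_poly coef_shuffle /= odd_double /=.
by rewrite uphalf_double.
Qed.

Lemma shuffleK (R : realType) (x : {poly R}) :
  shuffle (even_poly x) (odd_poly x) = x.
Proof.
apply/polyP => i; rewrite coef_shuffle coef_even_poly coef_odd_poly.
by rewrite -{4}(odd_double_half i); case: odd.
Qed.

Lemma cdconjP (R : realType) (c : R) (x y : {poly R}) :
  cdconj (c *: x + y) = c *: cdconj x + cdconj y.
Proof.
apply/polyP => i; rewrite coefD coefZ !coef_cdconj coefD coefZ.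
by case: ifP => // _; rewrite mulrN opprD.
Qed.

Lemma shuffleP (R : realType) (r : R) (a b c d : {poly R}) :
  shuffle (r *: a + c) (r *: b + d) = r *: shuffle a b + shuffle c d.
Proof.
apply/polyP => i; rewrite coefD coefZ !coef_shuffle !coefD !coefZ.
by case: odd.
Qed.

Lemma cdconjC (R : realType) (r : R) : cdconj r%:P = r%:P.
Proof.
apply/polyP => j; rewrite coef_cdconj coefC.
by case: (j == 0%N); rewrite ?oppr0.
Qed.

Lemma size_half_poly (R : realType) (x : {poly R}) n :
  (size x <= 2 ^ n.+1)%N ->
  (size (even_poly x) <= 2 ^ n)%N /\ (size (odd_poly x) <= 2 ^ n)%N.
Proof.
rewrite expnS mul2n => sx; split.
  apply: leq_trans (size_even_poly x) _.
  by rewrite leq_uphalf_double.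
apply: leq_trans (size_odd_poly x) _.
by rewrite -[X in (_ <= X)%N]doubleK half_leq.
Qed.

Lemma cddouble_ext (R : realType) P n
    (m1 m2 : {poly R} -> {poly R} -> {poly R}) :
  (forall x y : {poly R},
     (size x <= n)%N -> (size y <= n)%N -> m1 x y = m2 x y) ->
  forall a b c d : {poly R}, (size a <= n)%N -> (size b <= n)%N ->
    (size c <= n)%N -> (size d <= n)%N ->
  cddouble P m1 a b c d = cddouble P m2 a b c d.
Proof.
move=> E a b c d sa sb sc sd.
have sJ (x : {poly R}) : (size x <= n)%N -> (size (cdconj x) <= n)%N.
  by apply: leq_trans; exact: size_poly.
by case: P => /=; rewrite !E // ?sJ.
Qed.

Lemma cdmul_rec_step (R : realType) P n (x y : {poly R}) :
  (size x <= 2 ^ n)%N -> (size y <= 2 ^ n)%N ->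
  cdmul_rec P n.+1 x y = cdmul_rec P n x y.
Proof.
elim: n x y => [|n IHn] x y sx sy.
  rewrite (size1_polyC sx) (size1_polyC sy) /= !even_polyC !odd_polyC.
  rewrite -[RHS]shuffleK even_polyC odd_polyC.
  case: P; rewrite /= -polyC0 !cdconjC !coefC /= ?(mulr0, mul0r) ?(subr0, addr0) //;
  by rewrite mulrC.
have [sxe sxo] := size_half_poly sx; have [sye syo] := size_half_poly sy.
by rewrite /= -(cddouble_ext P IHn).
Qed.

Lemma cdmul_level (R : realType) P n (x y : {poly R}) :
  (size x <= 2 ^ n)%N -> (size y <= 2 ^ n)%N ->
  cdmul P x y = cdmul_rec P n x y.
Proof.
move=> sx sy; rewrite /cdmul; set m := up_log _ _.
have : (maxn (size x) (size y) <= 2 ^ m)%N by apply: up_logP.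
rewrite geq_max => /andP[sxm sym].
have : (m <= n)%N by apply: up_log_min => //; rewrite geq_max sx.
move=> /subnK <-; elim: (n - m)%N => [|k IHk]; first by rewrite add0n.
have le_mk : (2 ^ m <= 2 ^ (k + m))%N by rewrite leq_exp2l // leq_addl.
by rewrite addSn cdmul_rec_step // ?(leq_trans sxm) ?(leq_trans sym).
Qed.

Lemma cdmulC (R : realType) P (r s : R) : cdmul P r%:P s%:P = (r * s)%:P.
Proof. by rewrite (@cdmul_level R P 0) ?size_polyC_leq1 //= !coefC. Qed.

Lemma cdmul_shuffle (R : realType) P (a b c d : {poly R}) :
  cdmul P (shuffle a b) (shuffle c d) =
  let: (u, v) := cddouble P (cdmul P) a b c d in shuffle u v.
Proof.
set n := up_log 2 (maxn (size (shuffle a b)) (size (shuffle c d))).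
have : (maxn (size (shuffle a b)) (size (shuffle c d)) <= 2 ^ n)%N.
  exact: up_logP.
rewrite geq_max => /andP[s1 s2].
have le_n : (2 ^ n <= 2 ^ n.+1)%N by rewrite leq_exp2l.
have {}s1 := leq_trans s1 le_n; have {}s2 := leq_trans s2 le_n.
have [] := size_half_poly s1; rewrite even_shuffle odd_shuffle => sa sb.
have [] := size_half_poly s2; rewrite even_shuffle odd_shuffle => sc sd.
rewrite (cdmul_level P s1 s2) [LHS]/= !even_shuffle !odd_shuffle.
by rewrite (cddouble_ext P (fun x y sx sy => esym (cdmul_level P sx sy))).
Qed.

Lemma cdmul_rec_linear (R : realType) P n (r : R) (x y z : {poly R}) :
  cdmul_rec P n (r *: x + y) z = r *: cdmul_rec P n x z + cdmul_rec P n y z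
  /\ cdmul_rec P n z (r *: x + y)
     = r *: cdmul_rec P n z x + cdmul_rec P n z y.
Proof.
have E (u1 u2 v1 v2 : {poly R}) :
    r *: u1 + u2 - (r *: v1 + v2) = r *: (u1 - v1) + (u2 - v2).
  by rewrite scalerBr opprD addrACA.
have F (u1 u2 v1 v2 : {poly R}) :
    r *: u1 + u2 + (r *: v1 + v2) = r *: (u1 + v1) + (u2 + v2).
  by rewrite scalerDr addrACA.
elim: n x y z => [|n IHn] x y z /=.
  rewrite coefD coefZ mulrDl mulrDr !polyCD -!mul_polyC -!polyCM.
  by rewrite mulrA mulrCA.
have L x' y' z' := (IHn x' y' z').1; have L' x' y' z' := (IHn x' y' z').2.
rewrite !linearP /=.
by split; case: P L L' {IHn} => L L' /=;
  rewrite -shuffleP !(cdconjP, L, L') E F.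
Qed.

Lemma cdmul_bilinear (R : realType) P (r : R) (x y z : {poly R}) :
  cdmul P (r *: x + y) z = r *: cdmul P x z + cdmul P y z
  /\ cdmul P z (r *: x + y) = r *: cdmul P z x + cdmul P z y.
Proof.
pose m := maxn (size (r *: x + y)) (maxn (size x) (maxn (size y) (size z))).
have : (m <= 2 ^ up_log 2 m)%N by apply: up_logP.
set n := up_log 2 m; rewrite !geq_max => /and4P[s1 s2 s3 s4].
by rewrite !(@cdmul_level _ _ n) //; exact: cdmul_rec_linear.
Qed.

Lemma shuffleX0 (R : realType) k : shuffle 'X^k 0 = 'X^(k.*2) :> {poly R}.
Proof.
apply/polyP => i; rewrite coef_shuffle coef0 !coefXn.
rewrite -{3}(odd_double_half i); case: (odd i) => /=.
  by case: eqP => // /(congr1 odd); rewrite /= !odd_double.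
by rewrite add0n (inj_eq double_inj).
Qed.

Lemma shuffle0X (R : realType) k : shuffle 0 'X^k = 'X^(k.*2.+1) :> {poly R}.
Proof.
apply/polyP => i; rewrite coef_shuffle coef0 !coefXn.
rewrite -{3}(odd_double_half i); case: (odd i) => /=.
  by rewrite eqSS (inj_eq double_inj).
by case: eqP => // /(congr1 odd); rewrite /= !odd_double.
Qed.

Lemma lxor_half (p q : nat) :
  Nat.lxor p q = (odd p (+) odd q + (Nat.lxor p./2 q./2).*2)%N.
Proof.
have div2E n : Nat.div2 n = n./2.
  suff: Nat.div2 n = n./2 /\ Nat.div2 n.+1 = n.+1./2 by case.
  elim: n => // n [IH1 IH2]; split=> //.
  by rewrite [LHS]/= IH1.
have oddE n : Nat.odd n = odd n.
  suff: Nat.odd n = odd n /\ Nat.odd n.+1 = odd n.+1 by case.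
  elim: n => // n [IH1 IH2]; split=> //.
  by rewrite PeanoNat.Nat.odd_succ_succ IH1 /= negbK.
rewrite -[LHS]odd_double_half -div2E -oddE; congr (nat_of_bool _ + _.*2)%N.
  rewrite -PeanoNat.Nat.bit0_odd PeanoNat.Nat.lxor_spec.
  by rewrite !PeanoNat.Nat.bit0_odd !oddE; case: odd; case: odd.
by rewrite PeanoNat.Nat.div2_spec PeanoNat.Nat.shiftr_lxor
  -!PeanoNat.Nat.div2_spec !div2E.
Qed.

Lemma twist_exists_unique (R : realType) P :
  exists w, is_twist R P w /\
    forall w', is_twist R P w' -> forall p q, w' p q = w p q.
Proof.
have lin0 (x : {poly R}) : cdmul P 0 x = 0 /\ cdmul P x 0 = 0.
  have := cdmul_bilinear P (-1 : R) 0 0 x.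
  by rewrite scaler0 addr0 !scaleN1r !addNr.
have mulN (x y : {poly R}) : cdmul P (- x) y = - cdmul P x y
    /\ cdmul P x (- y) = - cdmul P x y.
  have [H _] := cdmul_bilinear P (-1 : R) x 0 y.
  have [_ K] := cdmul_bilinear P (-1 : R) y 0 x.
  by rewrite !scaleN1r !(lin0 _).1 !(lin0 _).2 !addr0 in H K.
have J0 : cdconj 0 = 0 :> {poly R} by rewrite -polyC0 cdconjC.
have JX k : cdconj 'X^k = (if k == 0%N then 'X^k else - 'X^k) :> {poly R}.
  apply/polyP => i; rewrite coef_cdconj (fun_if (fun f : {poly R} => f`_i)).
  rewrite coefN !coefXn.
  case: (i =P k) => [->//|_]; by rewrite oppr0 !if_same.
pose Sg k (x : {poly R}) := exists b : bool, x = (-1) ^+ b *: 'X^k.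
have SgX k : Sg k 'X^k by exists false; rewrite scale1r.
have SgN k x : Sg k x -> Sg k (- x).
  by move=> [b ->]; exists (~~ b); rewrite signrN scaleNr.
have SgJ k x : Sg k x -> Sg k (cdconj x).
  move=> [b ->]; rewrite -[_ *: _]addr0 cdconjP J0 addr0 JX.
  by exists (b (+) (k != 0%N)); case: eqP; case: b;
    rewrite /= ?(expr0, expr1) ?(scaleN1r, scale1r) ?opprK.
have SgE k x : Sg k x -> Sg k.*2 (shuffle x 0).
  move=> [b ->]; exists b; rewrite -shuffleX0.
  by rewrite -[_ *: shuffle _ _]addr0 -[X in _ + X](shuffleK 0)
    even_polyC odd_polyC -shuffleP scaler0 !addr0.
have SgO k x : Sg k x -> Sg k.*2.+1 (shuffle 0 x).
  move=> [b ->]; exists b; rewrite -shuffle0X.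
  by rewrite -[_ *: shuffle _ _]addr0 -[X in _ + X](shuffleK 0)
    even_polyC odd_polyC -shuffleP scaler0 !addr0.
have SgM p q l : Sg l (cdmul P 'X^p 'X^q) ->
    forall x y, Sg p x -> Sg q y -> Sg l (cdmul P x y).
  move=> H x y [b ->] [c ->].
  by case: b; case: c; rewrite /= ?(expr0, expr1) ?(scaleN1r, scale1r)
    ?((mulN _ _).1, (mulN _ _).2); auto.
have XE k : 'X^k = (if odd k then shuffle 0 'X^(k./2) else shuffle 'X^(k./2) 0)
    :> {poly R}.
  rewrite -{1}(odd_double_half k) shuffle0X shuffleX0.
  by case: (odd k); rewrite ?add0n.
have ex p q : Sg (Nat.lxor p q) (cdmul P 'X^p 'X^q).
  have [n] := ubnP (p + q)%N; elim: n p q => // n IHn p q; rewrite ltnS => le_n.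
  have [/eqP|pq0] := posnP (p + q)%N.
    rewrite addn_eq0 => /andP[/eqP-> /eqP->].
    by rewrite !expr0 -polyC1 cdmulC mulr1; exact: SgX.
  have lt_n : (p./2 + q./2 < n)%N.
    apply: leq_trans le_n.
    rewrite -[X in (_ < X + _)%N]odd_double_half.
    rewrite -[X in (_ < _ + X)%N]odd_double_half.
    move: pq0; rewrite -[in X in X -> _](odd_double_half p).
    rewrite -[in X in X -> _](odd_double_half q).
    by move: (odd p) (odd q) p./2 q./2 => b c i j; lia.
  have M := SgM _ _ _ (IHn p./2 q./2 lt_n).
  have := IHn q./2 p./2; rewrite addnC PeanoNat.Nat.lxor_comm => /(_ lt_n)/SgM M'.
  rewrite lxor_half (XE p) (XE q); case: (odd p); case: (odd q);
    rewrite /= ?(add0n, add1n) cdmul_shuffle; case: (P) M M' lin0 => /= M M' lin0.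
  all: rewrite ?J0 ?(lin0 _).1 ?(lin0 _).2 ?J0 ?(subr0, sub0r, addr0, add0r).
  all: rewrite ?(lin0 _).1 ?(lin0 _).2 ?(subr0, sub0r, addr0, add0r, oppr0).
  all: try by [apply: SgE; auto | apply: SgO; auto].
pose w p q : int :=
  if (cdmul P ('X^p : {poly R}) 'X^q)`_(Nat.lxor p q) == 1 then 1 else -1.
have neq1 : (-1 == 1 :> R) = false by rewrite eq_sym -addr_eq0 -mulr2n pnatr_eq0.
have wP p q : cdmul P ('X^p : {poly R}) 'X^q
    = (w p q)%:~R *: 'X^(Nat.lxor p q).
  have [b E] := ex p q; rewrite /w E coefZ coefXn eqxx mulr1.
  by case: b {E}; rewrite ?expr0 ?expr1 ?eqxx ?neq1 ?rmorphN1.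
exists w; split.
  by split=> // p q; rewrite /w; case: ifP; auto.
move=> w' [_ w'P] p q.
have := w'P p q; rewrite wP => /(congr1 (fun x : {poly R} => x`_(Nat.lxor p q))).
by rewrite !coefZ coefXn eqxx !mulr1 => /intr_inj.
Qed.

(* Main.v *)
(** Halving both indices turns the doubling formula into a recursion: up to
    swapping the arguments, [omega (2r + a) (2s + b)] is [omega r s] times a
    sign that depends only on [a], [b] and on which of [r], [s] vanish. When
    [p] and [q] have the same bit length [N], the first [N - 1] halvings are
    nonzero, with or without the common higher part [k 2^N], so both sides
    follow the same recursion down to [N = 1]. There the claim is
    [omega 1 1 = omega (2k+1) (2k+1)], and [omega n n = -1] for all [n > 0]. *)

Require Import Defs.
From mathcomp Require Import all_boot all_order all_algebra.
From mathcomp Require Import reals zify.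

Set Implicit Arguments.
Unset Strict Implicit.
Unset Printing Implicit Defensive.

Import GRing.Theory Num.Theory.
Local Open Scope ring_scope.

(** The eigenvalue of the basis vector ['X^n] under conjugation. *)
Definition conj_sign (n : nat) : int := if n == 0%N then 1 else -1.

Lemma conj_sign_sqr n : conj_sign n * conj_sign n = 1.
Proof. by rewrite /conj_sign; case: eqP. Qed.

(** The bits [a], [b] tell which half of each factor is nonzero, so exactly one of the four terms of
    the doubling formula survives; each entry is the sign of that term. *)
Definition twist_step (P : doubling_product) (w : nat -> nat -> int)
    (a b : bool) (r s : nat) : int :=
  match a, b with
  | false, false =>
      match P with P0 | P1 | P0T | P1T => w s r | _ => w r s end
  | false, true =>
      match P with
      | P0 | P2 => conj_sign r * w s r
      | P1 | P3 => conj_sign r * w r s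
      | P0T | P2T => w r s
      | P1T | P3T => w s r
      end
  | true, false =>
      match P with
      | P0 | P2 => w r s
      | P1 | P3 => w s r
      | P0T | P2T => conj_sign s * w s r
      | P1T | P3T => conj_sign s * w r s
      end
  | true, true =>
      - match P with
        | P0 | P2 => conj_sign r * w r s
        | P1 | P3 => conj_sign r * w s r
        | P0T | P2T => conj_sign s * w r s
        | P1T | P3T => conj_sign s * w s r
        end
  end.

Lemma cdconj0 (R : realType) : cdconj 0 = 0 :> {poly R}.
Proof. by rewrite -polyC0 cdconjC. Qed.

Lemma cdconjXn (R : realType) n :
  cdconj 'X^n = (conj_sign n)%:~R *: 'X^n :> {poly R}.
Proof.
apply/polyP => i; rewrite coef_cdconj coefZ !coefXn /conj_sign.
case: (i =P n) => [->|_]; last by rewrite oppr0 if_same mulr0.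
by case: eqP => _; rewrite ?rmorphN1 mulr1.
Qed.

Lemma shuffleZX0 (R : realType) (c : R) n :
  shuffle (c *: 'X^n) 0 = c *: 'X^(n.*2).
Proof.
apply/polyP => i; rewrite -shuffleX0 coefZ !coef_shuffle coefZ coef0.
by case: odd; rewrite ?mulr0.
Qed.

Lemma shuffle0ZX (R : realType) (c : R) n :
  shuffle 0 (c *: 'X^n) = c *: 'X^(n.*2.+1).
Proof.
apply/polyP => i; rewrite -shuffle0X coefZ !coef_shuffle coefZ coef0.
by case: odd; rewrite ?mulr0.
Qed.

Lemma Xn_shuffle (R : realType) (a : bool) r :
  'X^(a + r.*2) = (if a then shuffle 0 'X^r else shuffle 'X^r 0) :> {poly R}.
Proof. by case: a; rewrite ?shuffle0X ?shuffleX0. Qed.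

Section CdmulScale.
Variables (R : realType) (P : doubling_product).
Implicit Types x y : {poly R}.

Lemma cdmul0l x : cdmul P 0 x = 0.
Proof.
by have [+ _] := cdmul_bilinear P (-1) 0 0 x; rewrite scaler0 addr0 scaleN1r addNr.
Qed.

Lemma cdmul0r x : cdmul P x 0 = 0.
Proof.
by have [_ +] := cdmul_bilinear P (-1) 0 0 x; rewrite scaler0 addr0 scaleN1r addNr.
Qed.

Lemma cdmulZl c x y : cdmul P (c *: x) y = c *: cdmul P x y.
Proof. by have [+ _] := cdmul_bilinear P c x 0 y; rewrite cdmul0l !addr0. Qed.

Lemma cdmulZr c x y : cdmul P x (c *: y) = c *: cdmul P x y.
Proof. by have [_ +] := cdmul_bilinear P c y 0 x; rewrite cdmul0r !addr0. Qed.

End CdmulScale.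

Lemma twist_double (R : realType) P (w : nat -> nat -> int) :
  is_twist R P w -> forall (a b : bool) r s,
  w (a + r.*2)%N (b + s.*2)%N = twist_step P w a b r s.
Proof.
(* The sign is recovered as the coefficient of the product at the xor of the indices, hence the
   comparison in [R]. *)
move=> [_ wP] a b r s; apply: (@intr_inj R).
have /(congr1 (fun x : {poly R} => x`_(Nat.lxor (a + r.*2) (b + s.*2)))) :=
  wP (a + r.*2)%N (b + s.*2)%N.
rewrite coefZ coefXn eqxx mulr1 => <-.
have -> : Nat.lxor (a + r.*2) (b + s.*2) = (a (+) b + (Nat.lxor r s).*2)%N.
  by rewrite lxor_half !half_bit_double !oddD !odd_double !addbF !oddb.
have lxorC : Nat.lxor s r = Nat.lxor r s by exact: PeanoNat.Nat.lxor_comm.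
rewrite !Xn_shuffle.
case: a; case: b; rewrite cdmul_shuffle; case: P wP => wP /=.
all: rewrite ?cdconj0 ?cdconjXn ?cdmulZl ?cdmulZr ?cdmul0l ?cdmul0r ?scaler0.
all: rewrite ?subr0 ?sub0r ?add0r ?addr0 ?oppr0 ?wP.
all: rewrite ?lxorC ?scalerA -?scaleNr.
all: rewrite ?shuffleZX0 ?shuffle0ZX coefZ coefXn ?add0n ?add1n eqxx mulr1.
all: by rewrite ?rmorphN ?rmorphM.
Qed.

(** Equal indices have equal halves, so swapping is harmless. An odd index gives minus the square of
    a conjugation sign; an even positive one inherits the sign of its nonzero half. *)
Lemma twist_diag (R : realType) P (w : nat -> nat -> int) :
  is_twist R P w -> forall n, w n n = conj_sign n.
Proof.
move=> wP; have [_ wX] := wP; elim/ltn_ind => -[_|n IHn].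
  have := wX 0%N 0%N; rewrite expr0 -polyC1 cdmulC mulr1.
  move=> /(congr1 (fun x : {poly R} => x`_0)); rewrite coefZ !coefC mulr1 /=.
  by rewrite -[1](rmorph1 (intr : int -> R)) => /intr_inj.
have ltn : (n.+1./2 < n.+1)%N by lia.
rewrite -[n.+1 in LHS]odd_double_half (twist_double wP).
case: (boolP (odd n.+1)) => odd_n.
  by case: P {wP wX} => /=; rewrite (IHn _ ltn) conj_sign_sqr.
have half_neq0 : n.+1./2 != 0%N by lia.
by case: P {wP wX} => /=; rewrite (IHn _ ltn) /conj_sign (negPf half_neq0).
Qed.

Theorem theorem3 (R : realType) (P : doubling_product)
    (omega : nat -> nat -> int) (homega : is_twist R P omega)
    (p q k N : nat) (hN : (0 < N)%N)
    (hp : (2 ^ (N - 1) <= p < 2 ^ N)%N)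
    (hq : (2 ^ (N - 1) <= q < 2 ^ N)%N) :
  omega p q = omega (p + k * 2 ^ N)%N (q + k * 2 ^ N)%N.
Proof.
case: N hN hp hq => // N _; rewrite subn1 /=.
(* The induction hypothesis must cover the halves in either order, since some products exchange the
   factors. *)
elim: N p q => [|N IHN] p q hp hq.
  have -> : p = 1%N by lia.
  have -> : q = 1%N by lia.
  by rewrite !(twist_diag homega).
have half_bounds n : (2 ^ N.+1 <= n < 2 ^ N.+2)%N ->
    (2 ^ N <= n./2 < 2 ^ N.+1)%N.
  by rewrite !expnS; lia.
have half_neq0 n : (2 ^ N <= n < 2 ^ N.+1)%N -> (n == 0%N) = false.
  by have := expn_gt0 2 N; lia.
(* The shift is even: it keeps the low bit and passes to the half with one factor 2 less. *)
have shift n : (n + k * 2 ^ N.+2 = odd n + (n./2 + k * 2 ^ N.+1).*2)%N.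
  by rewrite doubleD addnA odd_double_half -mul2n mulnCA -expnS.
have {hp}hr := half_bounds _ hp; have {hq}hs := half_bounds _ hq.
rewrite 2!shift -[in LHS](odd_double_half p) -[in LHS](odd_double_half q).
rewrite !(twist_double homega) /twist_step /conj_sign !addn_eq0.
(* The halves are nonzero, hence so are the shifted ones: every conjugation sign is [-1] on both
   sides. *)
rewrite (half_neq0 _ hr) (half_neq0 _ hs) /=.
by rewrite -(IHN _ _ hr hs) -(IHN _ _ hs hr).
Qed.
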